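(* For the geometric Fibonacci chain with interval prototiles of lengths $\tau$ (type $a$) and $1$ (type $b$), where $\tau=\frac12(1+\sqrt5)$, the pair correlation coefficients $\nu_{\alpha\beta}(z)$, $\alpha,\beta\in\{a,b\}$, satisfy, for all $z\in\mathbb{Z}[\tau]$, the relations $$\begin{aligned} \nu_{aa}(z)&=\tfrac1\tau\bigl(\nu_{aa}(\tfrac z\tau)+\nu_{ab}(\tfrac z\tau)+\nu_{ba}(\tfrac z\tau)+\nu_{bb}(\tfrac z\tau)\bigr),\\ \nu_{ab}(z)&=\tfrac1\tau\bigl(\nu_{aa}(\tfrac z\tau-1)+\nu_{ba}(\tfrac z\tau-1)\bigr),\\ \nu_{ba}(z)&=\tfrac1\tau\bigl(\nu_{aa}(\tfrac z\tau+1)+\nu_{ab}(\tfrac z\tau+1)\bigr),\\ \nu_{bb}(z)&=\tfrac1\tau\,\nu_{aa}(\tfrac z\tau), \end{aligned}$$ and $\nu_{\alpha\beta}(z)=0$ whenever $z\notin\varLambda_\beta-\varLambda_\alpha$.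
   Context: The Fibonacci inflation rule is $\varrho: a\mapsto ab,\ b\mapsto a$, where $a$ is an interval of length $\tau$ and $b$ an interval of length $1$: each interval is stretched by the factor $\tau$ and dissected into intervals of original size, in the order given by the rule. Each tile is marked by its left endpoint. Let $\varLambda=\varLambda_a\,\dot\cup\,\varLambda_b$ be the set of left endpoints (split according to tile type) of the bi-infinite tiling of $\mathbb{R}$ that is fixed under $\varrho^2$ and arises from the seed $a|a$, with the marker $|$ at $0$. Equivalently, with $x\mapsto x^\star$ denoting algebraic conjugation $\sqrt5\mapsto-\sqrt5$ in $\mathbb{Q}(\sqrt5)$, $\varLambda_a=\{x\in\mathbb{Z}[\tau]: x^\star\in(\tau-2,\tau-1]\}$ and $\varLambda_b=\{x\in\mathbb{Z}[\tau]: x^\star\in(-1,\tau-2]\}$. The pair correlation coefficient $\nu_{\alpha\beta}(z)$ is the relative frequency (per point of $\varLambda$) of pairs of points at signed distance $z$ with the left one (base point) of type $\alpha$ and the right one of type $\beta$, that is, $$\nu_{\alpha\beta}(z)=\lim_{R\to\infty}\frac{\mathrm{card}\{x\in\varLambda_\alpha\cap(-R,R): x+z\in\varLambda_\beta\}}{\mathrm{card}(\varLambda\cap(-R,R))}.$$ These limits exist, and they are the same for all tilings in the hull of $\varLambda$ (the closure of its translation orbit in the local topology). *)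

(* Defs.v *)
From HB Require Import structures.
From mathcomp Require Import all_boot all_order all_algebra finmap ring lra.
From mathcomp Require Import all_classical all_reals all_analysis.

Set Implicit Arguments.
Unset Strict Implicit.
Unset Printing Implicit Defensive.

Import Order.TTheory GRing.Theory Num.Theory.
Import numFieldNormedType.Exports.

Local Open Scope classical_set_scope.
Local Open Scope ring_scope.

Inductive tile := Ta | Tb.

Definition tile_to_bool (t : tile) : bool := if t is Ta then true else false.
Definition tile_of_bool (c : bool) : tile := if c then Ta else Tb.

Lemma tile_to_boolK : cancel tile_to_bool tile_of_bool.
Proof. by case. Qed.

HB.instance Definition _ := Equality.copy tile (can_type tile_to_boolK).

Definition rho (t : tile) : seq tile :=
  match t with Ta => [:: Ta; Tb] | Tb => [:: Ta] end.

Definition tau (R : realType) : R := (1 + Num.sqrt 5) / 2.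
Arguments tau {R}.

Definition tile_length (R : realType) (t : tile) : R :=
  match t with Ta => tau | Tb => 1 end.

(* A placed tile (t, x) is the interval [x, x + tile_length t] of type t; it is
   marked by its left endpoint x. [lay x w] places the tiles of the word w
   consecutively from left to right, starting at x. *)
Fixpoint lay (R : realType) (x : R) (w : seq tile) : seq (tile * R) :=
  if w is t :: w' then (t, x) :: lay (x + tile_length R t) w' else [::].

(* The interval [x, x + l] is stretched to [tau * x, tau * (x + l)] and then
   dissected from its left endpoint according to rho; this fills it exactly,
   because tau ^+ 2 = tau + 1. *)
Definition inflate (R : realType) (T : set (tile * R)) : set (tile * R) :=
  \bigcup_(p in T) [set q | q \in lay (tau * p.2) (rho p.1)].

(* The seed a|a with the marker | at 0. *)
Definition seed (R : realType) : set (tile * R) :=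
  [set (Ta, - tau); (Ta, 0)].
Arguments seed : clear implicits.

(* Since the seed is contained in its image under the squared inflation
   ([seed_sub]), this union is increasing; it is a tiling of the line, fixed by
   the squared inflation ([fibonacci_chain_fixed]). *)
Definition fibonacci_chain (R : realType) : set (tile * R) :=
  \bigcup_n iter n (@inflate R \o @inflate R) (seed R).
Arguments fibonacci_chain : clear implicits.

Lemma tau_sqr (R : realType) : tau ^+ 2 = tau + 1 :> R.
Proof.
have h : Num.sqrt 5 ^+ 2 = 5 :> R by rewrite sqr_sqrtr// ler0n.
by rewrite /tau; lra.
Qed.

Lemma inflateS (R : realType) (S T : set (tile * R)) :
  S `<=` T -> inflate S `<=` inflate T.
Proof. by move=> ST q [p Sp pq]; exists p => //; exact: ST. Qed.

Lemma seed_sub (R : realType) : seed R `<=` inflate (inflate (seed R)).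
Proof.
have t2 := tau_sqr R.
move=> _ [|] ->.
- exists (Tb, tau * - tau + tau).
    exists (Ta, - tau); first by left.
    by rewrite /= !inE eqxx orbT.
  rewrite /= !inE; apply/eqP; congr (_, _).
  by rewrite mulrDr mulrN -expr2 t2; ring: t2.
- exists (Ta, 0); last by rewrite /= !inE mulr0 eqxx.
  exists (Ta, 0); first by right.
  by rewrite /= !inE mulr0 eqxx.
Qed.

Lemma fibonacci_chain_fixed (R : realType) :
  inflate (inflate (fibonacci_chain R)) = fibonacci_chain R.
Proof.
apply/seteqP; split=> [q [p [p' [n _ np'] p'p] pq]|q [[|n] _ nq]].
- by exists n.+1 => //=; exists p => //; exists p'.
- apply: (inflateS (inflateS _)) (seed_sub nq).
  by move=> x sx; exists 0%N.
- move: nq => /=; apply: inflateS; apply: inflateS.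
  by move=> x nx; exists n.
Qed.

Definition Lambda_ (R : realType) (al : tile) : set R :=
  [set x | fibonacci_chain R (al, x)].
Arguments Lambda_ : clear implicits.

Definition Lambda (R : realType) : set R := Lambda_ R Ta `|` Lambda_ R Tb.
Arguments Lambda : clear implicits.

(* [fset_set] sends infinite sets to the empty one; it is only applied below to
   subsets of the locally finite set Lambda in a bounded interval. *)
Definition card (R : realType) (A : set R) : nat := #|` fset_set A|%fset.

Definition pair_ratio (R : realType) (al be : tile) (z r : R) : R :=
  (card [set x | Lambda_ R al x /\ - r < x < r /\ Lambda_ R be (x + z)])%:R /
  (card [set x | Lambda R x /\ - r < x < r])%:R.

Definition nu (R : realType) (al be : tile) (z : R) : R :=
  lim (pair_ratio al be z r @[r --> +oo]).

Definition Ztau (R : realType) : set R :=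
  [set x | exists m n : int, x = m%:~R + n%:~R * tau].
Arguments Ztau : clear implicits.

(* Main.v *)
Require Import Defs.
From HB Require Import structures.
From mathcomp Require Import all_boot all_order all_algebra finmap.
From mathcomp Require Import all_classical all_reals all_analysis.
From mathcomp Require Import ring lra zify.
Import Order.TTheory GRing.Theory Num.Theory.
Import numFieldNormedType.Exports.
Local Open Scope classical_set_scope.
Local Open Scope ring_scope.

(* In terms of the star map, the chain is the model set with windows
   (tau - 2, tau - 1] and (-1, tau - 2].  Inflation multiplies star images by
   -1/tau and so maps this model set to the one with the opposite endpoints
   and back; going up to ancestors contracts by 1/tau, so equality with the
   chain has to be checked only near the origin.

   An interval of star images with endpoints in Z[tau] is a bounded remainder
   set: its counting function is a difference of sums of floor (c - i * theta),
   theta = 1 - tau, and translating c by 1 or by theta changes such a sum by a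
   constant or a telescoping term.  Hence points x with |x| < r and star image
   in (a, b] number (b - a) * 2 r / sqrt 5 + O(1), which gives
   nu al be z = |W_al `&` (W_be - w)| / tau, w the star image of z.  The
   relations then express that z |-> z / tau scales windows by -tau in
   internal space. *)

(** * Arithmetic of Z[tau] and its star map *)

Lemma tau_bounds (R : realType) : 3 / 2 < (tau : R) < 2.
Proof.
have t2 := tau_sqr R.
have t0 : 0 <= (tau : R) by rewrite divr_ge0 ?addr_ge0 ?sqrtr_ge0.
by apply/andP; split; rewrite ltNge; apply/negP => h; nra.
Qed.

(* The star map, algebraic conjugation, sends [ztau m n] to [zstar m n], since
   1 - tau is the conjugate of tau. *)
Definition ztau {R : realType} (m n : int) : R := m%:~R + n%:~R * tau.
Definition zstar {R : realType} (m n : int) : R := m%:~R + n%:~R * (1 - tau).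

(** Here [2 * tau - 1] is the square root of 5. When the star image is bounded, [n] thus determines
    the position up to a bounded error. *)
Lemma ztau_zstar (R : realType) (m n : int) :
  ztau m n = zstar m n + n%:~R * (2 * tau - 1) :> R.
Proof. by rewrite /ztau /zstar; ring. Qed.

Lemma ztauD (R : realType) (m n p q : int) :
  ztau (m + p) (n + q) = ztau m n + ztau p q :> R.
Proof. by rewrite /ztau !intrD; ring. Qed.

Lemma zstarD (R : realType) (m n p q : int) :
  zstar (m + p) (n + q) = zstar m n + zstar p q :> R.
Proof. by rewrite /zstar !intrD; ring. Qed.

Lemma ztauB (R : realType) (m n p q : int) :
  ztau (m - p) (n - q) = ztau m n - ztau p q :> R.
Proof. by rewrite /ztau !intrB; ring. Qed.

Lemma mul_tau_ztau (R : realType) (m n : int) : tau * ztau m n = ztau n (m + n) :> R.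
Proof. by have t2 := tau_sqr R; rewrite /ztau !intrD; ring: t2. Qed.

Lemma zstar_tau (R : realType) (m n : int) :
  zstar m n = - tau * zstar n (m + n) :> R.
Proof. by have t2 := tau_sqr R; rewrite /zstar !intrD; ring: t2. Qed.

Lemma zstar_div_tau (R : realType) (m n : int) :
  zstar (n - m) m = - tau * zstar m n :> R.
Proof. by rewrite zstar_tau; congr (_ * zstar _ _); ring. Qed.

Lemma ztauD1 (R : realType) (m n : int) : ztau (m + 1) n = ztau m n + 1 :> R.
Proof. by rewrite /ztau intrD; ring. Qed.

Lemma ztauB1 (R : realType) (m n : int) : ztau (m - 1) n = ztau m n - 1 :> R.
Proof. by rewrite /ztau intrB; ring. Qed.

Lemma zstarD1 (R : realType) (m n : int) : zstar (m + 1) n = zstar m n + 1 :> R.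
Proof. by rewrite /zstar intrD; ring. Qed.

Lemma zstarB1 (R : realType) (m n : int) : zstar (m - 1) n = zstar m n - 1 :> R.
Proof. by rewrite /zstar intrB; ring. Qed.

(** For nonzero [b], the exponent of 5 would be even on the left and odd on the right. *)
Lemma sqr_eq_mul5_eq0 (a b : nat) : (a * a = 5 * (b * b))%N -> b = 0%N.
Proof.
case: b => // b e; case: a e => // a e.
have /(congr1 odd) : logn 5 (a.+1 * a.+1) = (1 + (logn 5 b.+1).*2)%N.
  by rewrite e !lognM // logn_prime // eqxx addnn.
by rewrite lognM // addnn oddD !odd_double.
Qed.

Lemma ztau_eq0 (R : realType) (m n : int) : ztau m n = 0 :> R -> m = 0 /\ n = 0.
Proof.
rewrite /ztau => e; have t2 := tau_sqr R.
(* Completing the square in the norm form m^2 + m n - n^2 of Z[tau]. *)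
have e5 : ((2 * m + n) * (2 * m + n))%:~R = (5 * (n * n))%:~R :> R.
  rewrite !intrM !intrD !intrM.
  have -> : m%:~R = - (n%:~R * tau) :> R by lra.
  by ring: t2.
move/intr_inj: e5 => /(congr1 absz); rewrite !abszM => /sqr_eq_mul5_eq0 n0.
have {}n0 : n = 0 by lia.
by split=> //; apply/eqP; rewrite -(intr_eq0 R) -e n0 mul0r addr0.
Qed.

Lemma ztau_inj (R : realType) (m n p q : int) :
  ztau m n = ztau p q :> R -> m = p /\ n = q.
Proof.
move=> e; have [] := ztau_eq0 R (m - p) (n - q); first by rewrite ztauB e subrr.
by move=> /subr0_eq -> /subr0_eq ->.
Qed.

(** * Windows and the action of inflation on model sets *)

Definition win_lo {R : realType} (t : tile) : R :=
  if t is Ta then tau - 2 else -1.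
Definition win_hi {R : realType} (t : tile) : R :=
  if t is Ta then tau - 1 else tau - 2.

(* The window is closed on the right for [c = true], on the left otherwise;
   the star map reverses orientation under multiplication by tau, so the
   inflation swaps the two cases. *)
Definition in_win {R : realType} (c : bool) (t : tile) (y : R) : bool :=
  if c then win_lo t < y <= win_hi t else win_lo t <= y < win_hi t.

Definition model (R : realType) (c : bool) : set (tile * R) :=
  [set p | exists m n, p.2 = ztau m n /\ in_win c p.1 (zstar m n : R)].

(** Both words [rho s] begin with [Ta], and [Ta] occurs nowhere else in them. *)
Lemma inflate_Ta (R : realType) (T : set (tile * R)) (x : R) :
  inflate T (Ta, x) <-> exists s, T (s, x / tau).
Proof.
have tb := tau_bounds R; have t0 : tau != 0 :> R by lra.
split=> [[[[] y] Ty]|[s Ts]].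
- rewrite /= !inE => /orP[/eqP[->]|/eqP[]//].
  by exists Ta; rewrite mulrC mulKf.
- rewrite /= !inE => /eqP[->].
  by exists Tb; rewrite mulrC mulKf.
- exists (s, x / tau) => //=; rewrite mulrC divfK //.
  by case: s {Ts}; rewrite !inE eqxx.
Qed.

Lemma inflate_Tb (R : realType) (T : set (tile * R)) (x : R) :
  inflate T (Tb, x) <-> T (Ta, x / tau - 1).
Proof.
have tb := tau_bounds R; have t0 : tau != 0 :> R by lra.
split=> [[[[] y] Ty]|Ts].
- rewrite /= !inE => /orP[/eqP[]//|/eqP[->]].
  by rewrite mulrDl divff // mulrC mulKf // addrK.
- by rewrite /= !inE => /eqP[].
- exists (Ta, x / tau - 1) => //=.
  have -> : tau * (x / tau - 1) + tau = x.
    by rewrite mulrBr mulr1 subrK mulrC divfK.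
  by rewrite !inE eqxx orbT.
Qed.

Lemma ztau_div_tau (R : realType) (m n : int) :
  ztau m n / tau = ztau (n - m) m :> R.
Proof.
have tb := tau_bounds R; have t0 : tau != 0 :> R by lra.
apply: (mulIf t0); rewrite divfK // [RHS]mulrC mul_tau_ztau.
by congr ztau; ring.
Qed.

(** The factor -1/tau sends the whole window from -1 to tau - 1 onto the window of [Ta]. The same
    factor followed by the shift 1 - tau, the star image of the offset tau of [Tb], sends the window
    of [Ta] onto that of [Tb]. *)
Lemma inflate_model (R : realType) (c : bool) :
  inflate (model R c) = model R (~~ c).
Proof.
have tb := tau_bounds R; have t2 := tau_sqr R; have t0 : tau != 0 :> R by lra.
apply/seteqP; split=> -[[] x].
- move=> /inflate_Ta[s [m [n /= [e w]]]].
  exists n, (m + n); split; first by rewrite /= -mul_tau_ztau -e mulrC divfK.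
  by move: w; rewrite zstar_tau; case: c; case: s => /= /andP[w1 w2]; apply/andP; split; nra.
- move=> /inflate_Tb[m [n /= [e w]]].
  exists n, (m + n + 1); split.
    have -> : x = tau * (x / tau - 1) + tau.
      by rewrite mulrBr mulr1 subrK mulrC divfK.
    by rewrite /= e mul_tau_ztau /ztau !intrD; ring.
  have sE : zstar n (m + n + 1) = zstar n (m + n) + (1 - tau) :> R.
    by rewrite /zstar !intrD; ring.
  by move: w; rewrite zstar_tau sE; case: c => /= /andP[w1 w2]; apply/andP; split; nra.
- move=> [m [n /= [-> w]]]; apply/inflate_Ta; rewrite ztau_div_tau.
  have [h|h] : in_win c Ta (zstar (n - m) m : R) \/ in_win c Tb (zstar (n - m) m : R).
    move: w; rewrite zstar_div_tau; case: c => /= /andP[w1 w2].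
      by case: (leP (-tau * zstar m n) (tau - 2 : R)) => h; [right|left];
        apply/andP; split; rewrite //; nra.
    by case: (ltP (-tau * zstar m n) (tau - 2 : R)) => h; [right|left];
        apply/andP; split; rewrite //; nra.
  + by exists Ta, (n - m), m.
  + by exists Tb, (n - m), m.
- move=> [m [n /= [-> w]]]; apply/inflate_Tb; rewrite ztau_div_tau.
  exists (n - m - 1), m; split; first by rewrite ztauB1.
  rewrite zstarB1 zstar_div_tau.
  by move: w; case: c => /= /andP[w1 w2]; apply/andP; split; nra.
Qed.

(** * The chain is a model set *)

Lemma int_eq0_or_N1 (n : int) : -2 < n < 1 -> n = 0 \/ n = -1.
Proof. by lia. Qed.

(** The 2-cycle of the inflation, indexed so as to run parallel to the two model sets. *)
Definition chain (R : realType) (c : bool) : set (tile * R) :=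
  if c then fibonacci_chain R else inflate (fibonacci_chain R).

Lemma inflate_chain (R : realType) (c : bool) :
  inflate (chain R c) = chain R (~~ c).
Proof. by case: c => //=; exact: fibonacci_chain_fixed. Qed.

Lemma chain_sub_model (R : realType) (c : bool) : chain R c `<=` model R c.
Proof.
have tb := tau_bounds R.
suff F : fibonacci_chain R `<=` model R true.
  by case: c => //=; rewrite -(inflate_model R true); exact: inflateS.
move=> p [n _]; elim: n p => [|n IH] p /=.
  case=> -> /=; rewrite /model /=.
    exists 0, (-1); split; first by rewrite /ztau; ring.
    by rewrite /zstar; apply/andP; split; lra.
  exists 0, 0; split; first by rewrite /ztau; ring.
  by rewrite /zstar; apply/andP; split; lra.
rewrite -[model R true](inflate_model R false) -(inflate_model R true).
by apply: inflateS; apply: inflateS.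
Qed.

(** These are all the tiles whose left endpoint lies strictly between -tau - 2 and 1, as
    [model_near0] confirms. *)
Lemma chain_near0 (R : realType) (c : bool) :
  [/\ chain R c (Ta, 0),
      chain R c (if c then (Ta, - tau) else (Tb, - 1)) &
      chain R c (if c then (Tb, - tau - 1) else (Ta, - tau - 1))].
Proof.
have tb := tau_bounds R; have t2 := tau_sqr R; have t0 : tau != 0 :> R by lra.
have F0 : chain R true (Ta, 0) by exists 0%N => //; right.
have F1 : chain R true (Ta, - tau) by exists 0%N => //; left.
have F0' : chain R false (Ta, 0).
  by rewrite -(inflate_chain R true); apply/inflate_Ta; rewrite mul0r; exists Ta.
have F1' : chain R false (Tb, -1).
  rewrite -(inflate_chain R true); apply/inflate_Tb.
  have -> // : -1 / tau - 1 = - tau :> R.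
  by apply: (mulIf t0); rewrite mulrBl divfK //; lra.
have F2' : chain R false (Ta, - tau - 1).
  rewrite -(inflate_chain R true); apply/inflate_Ta; exists Ta.
  have -> // : (- tau - 1) / tau = - tau :> R.
  by apply: (mulIf t0); rewrite divfK //; lra.
case: c; split=> //.
rewrite -(inflate_chain R false); apply/inflate_Tb.
have -> // : (- tau - 1) / tau - 1 = - tau - 1 :> R.
by apply: (mulIf t0); rewrite mulrBl divfK //; lra.
Qed.

(** Bounds on both the position and its star image force [m] and [n] into {0, -1}; the four
    candidates are then checked against the windows. *)
Lemma model_near0 (R : realType) (c : bool) (t : tile) (x : R) :
  model R c (t, x) -> - (tau + 1) - 1 < x < 1 -> chain R c (t, x).
Proof.
have tb := tau_bounds R.
move=> [m [n [/= -> w]]] xb; have pE := ztau_zstar R m n.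
have stb : -1 <= (zstar m n : R) <= tau - 1.
  by case: c w; case: t => /= /andP[w1 w2]; apply/andP; split; lra.
have n1 : n < 1.
  rewrite ltNge -(ler_int R); apply/negP => h.
  have : 1 * (2 * tau - 1) <= n%:~R * (2 * tau - 1) :> R by rewrite ler_wpM2r //; lra.
  by lra.
have n2 : -2 < n.
  rewrite ltNge -(ler_int R); apply/negP => h.
  have : n%:~R * (2 * tau - 1) <= (-2) * (2 * tau - 1) :> R by rewrite ler_wpM2r //; lra.
  by lra.
have [c0 c1 c2] := chain_near0 R c.
have mE : zstar m n = m%:~R + n%:~R - n%:~R * tau :> R by rewrite /zstar; ring.
have [n0|n0] : n = 0 \/ n = -1 by apply: int_eq0_or_N1; rewrite n1 n2.
- have [m0|m0] : m = 0 \/ m = -1.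
    by apply: int_eq0_or_N1; rewrite -!(ltr_int R);
      move: mE stb; rewrite n0 => -> ?; apply/andP; split; lra.
  + have -> : ztau m n = 0 :> R by rewrite m0 n0 /ztau; ring.
    move: w; rewrite mE m0 n0; case: t => // w; exfalso.
    by case: c {c0 c1 c2} w => /= /andP[w1 w2]; lra.
  + have -> : ztau m n = -1 :> R by rewrite m0 n0 /ztau; ring.
    move: w; rewrite mE m0 n0; case: c c1 {c0 c2} => c1; case: t => // w; exfalso;
      by move: w => /= /andP[w1 w2]; lra.
- have [m0|m0] : m = 0 \/ m = -1.
    by apply: int_eq0_or_N1; rewrite -!(ltr_int R);
      move: mE stb; rewrite n0 => -> ?; apply/andP; split; lra.
  + have -> : ztau m n = - tau :> R by rewrite m0 n0 /ztau; ring.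
    move: w; rewrite mE m0 n0; case: c c1 {c0 c2} => c1; case: t => // w; exfalso;
      by move: w => /= /andP[w1 w2]; lra.
  + have -> : ztau m n = - tau - 1 :> R by rewrite m0 n0 /ztau; ring.
    move: w; rewrite mE m0 n0; case: c c2 {c0 c1} => c2; case: t => // w; exfalso;
      by move: w => /= /andP[w1 w2]; lra.
Qed.

(* The tile containing x has an ancestor over x / tau, so every tile descends
   from one of the finitely many tiles near the origin. *)
Lemma model_chain_bounded (R : realType) (k : nat) (c : bool) (t : tile) (x : R) :
  model R c (t, x) -> - (tau + 1) - tau ^+ k < x < tau ^+ k -> chain R c (t, x).
Proof.
have tb := tau_bounds R; have t2 := tau_sqr R; have t0 : 0 < tau :> R by lra.
elim: k c t x => [|k IH] c t x; first by rewrite expr0; exact: model_near0.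
rewrite exprS -[c]negbK -inflate_model -inflate_chain => Mx xb.
have [y yE] : exists y, x / tau = y by exists (x / tau).
have xE : x = tau * y by rewrite -yE mulrC divfK // gt_eqF.
(* The offset s = tau + 1 solves tau * s = s + tau, so the lower bound survives the shift by 1 in
   the parent of a [Tb] tile. *)
have yb : - (tau + 1) - tau ^+ k < y - 1 /\ y < tau ^+ k.
  move: xb; rewrite xE => /andP[x1 x2].
  by split; [rewrite -(ltr_pM2l t0); lra|rewrite -(ltr_pM2l t0)].
case: t Mx => [/inflate_Ta[s Ms]|/inflate_Tb Ms].
  apply/inflate_Ta; exists s; rewrite yE in Ms *.
  by apply: IH => //; apply/andP; split; lra.
apply/inflate_Tb; rewrite yE in Ms *.
by apply: IH => //; apply/andP; split; lra.
Qed.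

(** A Bernoulli bound, ensuring that the ranges in [model_chain_bounded] exhaust the line. *)
Lemma tau_expr_ge (R : realType) (k : nat) : k%:R / 2 <= tau ^+ k :> R.
Proof.
have tb := tau_bounds R.
suff : 1 + k%:R / 2 <= tau ^+ k :> R by lra.
elim: k => [|k IH]; first by rewrite expr0; lra.
by rewrite exprS -natr1; have : 0 <= k%:R :> R by []; nra.
Qed.

Lemma chain_model (R : realType) (c : bool) : chain R c = model R c.
Proof.
have tb := tau_bounds R.
apply/seteqP; split; first exact: chain_sub_model.
move=> -[t x] Mx.
pose k := (Num.truncn (2 * `|x|)).+1.
have xk : 2 * `|x| < k%:R by rewrite truncnS_gt.
have qk := tau_expr_ge R k.
apply: (@model_chain_bounded R k) => //.
by case: (lerP 0 x) xk => x0; [rewrite ger0_norm|rewrite ltr0_norm] => // xk;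
  apply/andP; split; lra.
Qed.

Lemma LambdaP (R : realType) (al : tile) (x : R) :
  Lambda_ R al x <-> exists m n, x = ztau m n /\ win_lo al < (zstar m n : R) <= win_hi al.
Proof. by rewrite /Lambda_ /= -[fibonacci_chain R]/(chain R true) chain_model. Qed.

(** * Bounded remainder sets *)

Definition floor_sum {R : realType} (theta c : R) (M : nat) : R :=
  \sum_(0 <= i < M) (Num.floor (c - i%:R * theta))%:~R.

(** Uniformity in [c] makes the admissible [t] a group: the bound for a sum uses the second bound at
    a translated [c]. *)
Definition bounded_discrepancy {R : realType} (theta t : R) : Prop :=
  exists C : R, forall (c : R) (M : nat),
    `|floor_sum theta (c + t) M - floor_sum theta c M - M%:R * t| <= C.

Lemma bounded_discrepancyD (R : realType) (theta s t : R) :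
  bounded_discrepancy theta s -> bounded_discrepancy theta t ->
  bounded_discrepancy theta (s + t).
Proof.
move=> [C hC] [D hD]; exists (C + D) => c M.
apply: le_trans (lerD (hC c M) (hD (c + s) M)).
apply: le_trans (ler_normD _ _); rewrite addrA le_eqVlt.
by apply/orP; left; apply/eqP; congr `|_|; ring.
Qed.

Lemma bounded_discrepancyN (R : realType) (theta t : R) :
  bounded_discrepancy theta t -> bounded_discrepancy theta (- t).
Proof.
move=> [C hC]; exists C => c M.
have := hC (c - t) M; rewrite subrK -normrN.
by congr (`|_| <= _); ring.
Qed.

Lemma bounded_discrepancyMz (R : realType) (theta t : R) (p : int) :
  bounded_discrepancy theta t -> bounded_discrepancy theta (p%:~R * t).
Proof.
move=> ht.
have hn (n : nat) : bounded_discrepancy theta (n%:R * t).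
  elim: n => [|n IH].
    by exists 0 => c M; rewrite mul0r addr0 subrr mulr0 subr0 normr0.
  by rewrite -natr1 mulrDl mul1r; exact: bounded_discrepancyD.
case: p => n; first exact: hn.
by rewrite NegzE mulrNz mulNr; apply: bounded_discrepancyN; exact: hn.
Qed.

Lemma bounded_discrepancy1 (R : realType) (theta : R) :
  bounded_discrepancy theta 1.
Proof.
exists 0 => c M; rewrite /floor_sum -sumrB.
under eq_bigr do rewrite addrAC floorDrz ?int_num1 // floor1 intrD addrAC subrr add0r.
by rewrite sumr_const_nat subn0 mulr1 subrr normr0.
Qed.

(* Translating by theta shifts the index of summation, so the sum telescopes. *)
Lemma bounded_discrepancy_step (R : realType) (theta : R) :
  bounded_discrepancy theta theta.
Proof.
(* What remains after telescoping is a difference of two fractional parts. *)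
exists 1 => c M; rewrite /floor_sum -sumrB.
pose g (k : nat) : R := (Num.floor (c + theta - k%:R * theta))%:~R.
have -> : \sum_(0 <= i < M) ((Num.floor (c + theta - i%:R * theta))%:~R
    - (Num.floor (c - i%:R * theta))%:~R) = g 0%N - g M :> R.
  rewrite -[RHS]opprB -telescope_sumr // -sumrN; apply: eq_bigr => i _.
  by rewrite opprB /g -natr1; congr (_ - (Num.floor _)%:~R); ring.
rewrite /g mul0r subr0.
have /andP[f1 f2] := floor_itv (c + theta).
have /andP[f3 f4] := floor_itv (c + theta - M%:R * theta).
rewrite !intrD in f2 f4.
by rewrite ler_norml; apply/andP; split; lra.
Qed.

(** The easy direction of the Hecke-Kesten theorem: admissible lengths include the group generated
    by 1 and theta. *)
Lemma bounded_discrepancy_zstar (R : realType) (p q : int) :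
  bounded_discrepancy (1 - tau) (zstar p q : R).
Proof.
rewrite /zstar -[p%:~R]mulr1.
by apply: bounded_discrepancyD; apply: bounded_discrepancyMz;
  [exact: bounded_discrepancy1|exact: bounded_discrepancy_step].
Qed.

(** * Counting the points of a window *)

Lemma card_le_size (R : realType) (A : set R) (s : seq R) :
  A `<=` [set` s] -> (Defs.card A <= size s)%N.
Proof.
move=> As; have fA : finite_set A by apply: sub_finite_set As (finite_seq s).
apply: uniq_leq_size => [|x]; first exact: fset_uniq.
by rewrite in_fset_set // inE => /As.
Qed.

Lemma size_le_card (R : realType) (A : set R) (s : seq R) :
  finite_set A -> uniq s -> [set` s] `<=` A -> (size s <= Defs.card A)%N.
Proof.
move=> fA us sA; apply: uniq_leq_size => // x xs.
by rewrite in_fset_set // inE; exact: sA.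
Qed.

(** Listing the points fibre by fibre over [n] makes the size a sum of floor differences. The [+ 1]
    reflects the open left end of the interval of star images. *)
Definition box {R : realType} (a b : R) (n0 : int) (M : nat) : seq R :=
  let f (c : R) (i : nat) := Num.floor (c - (n0 + i%:Z)%:~R * (1 - tau)) in
  [seq ztau (f a i + 1 + j%:Z) (n0 + i%:Z)
     | i <- iota 0 M, j <- iota 0 `|f b i - f a i|%N].

Lemma mem_box (R : realType) (a b : R) (n0 : int) (M : nat) (x : R) : a <= b ->
  x \in box a b n0 M <->
  exists m n, [/\ x = ztau m n, n0 <= n < n0 + M%:Z & a < (zstar m n : R) <= b].
Proof.
move=> ab.
(* A half-open interval, closed on the right, corresponds exactly to inequalities between integers
   and floors, without boundary cases. *)
have fP (m n : int) : (a < (zstar m n : R) <= b) =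
    (Num.floor (a - n%:~R * (1 - tau)) < m <= Num.floor (b - n%:~R * (1 - tau))).
  by rewrite floor_lt_int floor_ge_int ltrBlDr lerBrDr.
have fab (n : int) :
    Num.floor (a - n%:~R * (1 - tau)) <= Num.floor (b - n%:~R * (1 - tau)).
  by apply: le_floor; rewrite lerD2r.
split=> [/allpairsPdep[i [j]]|[m [n [-> nM]]]].
  rewrite !mem_iota /= !add0n => -[iM jk ->].
  do 2!eexists; split; [reflexivity|lia|].
  have := fab (n0 + i%:Z); rewrite fP; lia.
rewrite fP => mn.
apply/allpairsPdep; exists `|n - n0|%N.
have -> : n0 + `|n - n0|%N%:Z = n by lia.
exists (absz (m - (Num.floor (a - n%:~R * (1 - tau)) + 1))%R).
rewrite !mem_iota /= !add0n; split; [lia|lia|].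
by congr ztau; lia.
Qed.

Lemma box_uniq (R : realType) (a b : R) (n0 : int) (M : nat) :
  uniq (box a b n0 M).
Proof.
apply: allpairs_uniq_dep => [|i _|]; rewrite ?iota_uniq //.
move=> [i j] [i' j'] _ _ /= /ztau_inj[e1 e2].
have {e2} ii : i = i' by lia.
by move: e1; rewrite ii => e1; congr Tagged; lia.
Qed.

Lemma size_box (R : realType) (a b : R) (n0 : int) (M : nat) : a <= b ->
  (size (box a b n0 M))%:R =
  floor_sum (1 - tau) (b - n0%:~R * (1 - tau)) M
  - floor_sum (1 - tau) (a - n0%:~R * (1 - tau)) M.
Proof.
move=> ab; rewrite size_allpairs_dep sumnE big_map natr_sum /floor_sum -sumrB.
rewrite /index_iota subn0; apply: eq_bigr => i _; rewrite size_iota.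
have E c : c - (n0 + i%:Z)%:~R * (1 - tau) =
    c - n0%:~R * (1 - tau) - i%:R * (1 - tau) :> R by rewrite intrD; ring.
rewrite !E -intrB -[LHS]/((Posz _)%:~R); congr intmul.
rewrite gez0_abs // subr_ge0; apply: le_floor.
by rewrite !lerD2r.
Qed.

Definition window {R : realType} (a b r : R) : set R :=
  [set x | exists m n, [/\ x = ztau m n, - r < x < r & a < (zstar m n : R) <= b]].

Lemma window_sub_box (R : realType) (a b r K : R) (N : nat) :
  a <= b -> - K <= a -> b <= K -> r + K < N%:R * (2 * tau - 1) ->
  window a b r `<=` [set` box a b (- N%:Z) (N + N)].
Proof.
move=> ab aK bK rN x [m [n [-> xr w]]] /=.
apply/mem_box => //; exists m, n; split => //.
have tb := tau_bounds R; have s0 : 0 < 2 * tau - 1 :> R by lra.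
have pE := ztau_zstar R m n.
suff : - N%:Z < n < N%:Z by clear; lia.
rewrite -!(ltr_int R) intrN.
by apply/andP; split; rewrite -(ltr_pM2r s0); lra.
Qed.

(** The alternative [N = 0] gives an empty box and covers radii below [K]. Since [b] itself can be a
    star image, [b < K] is strict in order to get [x < r]. *)
Lemma box_sub_window (R : realType) (a b r K : R) (N : nat) :
  a <= b -> - K <= a -> b < K -> (N = 0%N \/ N%:R * (2 * tau - 1) <= r - K) ->
  [set` box a b (- N%:Z) (N + N)] `<=` window a b r.
Proof.
move=> ab aK bK rN x /= /mem_box[//|m [n [-> nN w]]].
exists m, n; split => //.
case: rN => [N0|rN]; first by move: nN; rewrite N0; clear; lia.
have tb := tau_bounds R; have s0 : 0 <= 2 * tau - 1 :> R by lra.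
have : - N%:Z <= n <= N%:Z by move: nN; clear; lia.
rewrite -!(ler_int R) intrN => /andP[/(ler_wpM2r s0) h1 /(ler_wpM2r s0) h2].
by move: h1 h2; rewrite /= ztau_zstar => h1 h2; apply/andP; split; lra.
Qed.

Definition asymp_linear {R : realType} (f : R -> R) (l : R) : Prop :=
  exists C : R, forall r : R, 0 <= r -> `|f r - l * r| <= C.

(** The window is squeezed between boxes with [N] close to (r + K) / s and (r - K) / s. A box has 2
    N (b - a) points up to the discrepancy bound, as b - a lies in Z[tau]. *)
Lemma card_window (R : realType) (a b : R) (p q : int) :
  a <= b -> b - a = zstar p q ->
  asymp_linear (fun r => (Defs.card (window a b r))%:R)
    (2 / (2 * tau - 1) * (b - a)).
Proof.
move=> ab pq; have tb := tau_bounds R.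
set s : R := 2 * tau - 1; have s0 : 0 < s by rewrite /s; lra.
have [C hC] := bounded_discrepancy_zstar R p q.
have hbox (N : nat) :
    `|(size (box a b (- N%:Z) (N + N)))%:R - 2 * N%:R * (b - a)| <= C.
  rewrite size_box // pq.
  have -> : b = a + zstar p q by rewrite -pq; ring.
  rewrite [a + _ - _]addrAC; apply: le_trans (hC _ (N + N)%N).
  by rewrite natrD mulr2n mulrDl mul1r.
pose K : R := `|a| + `|b| + 1.
have [K1 K2 K3 K4] : [/\ - K <= a, b < K, b <= K & 0 < K].
  have a1 := ler_norm (- a); rewrite normrN in a1; have b1 := ler_norm b.
  have a0 := normr_ge0 a; have b0 := normr_ge0 b.
  by rewrite /K; split; lra.
(* [C] is the discrepancy; [K / s] and 1 bound the changes of [N] due to the margin [K] and to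
   rounding. *)
exists (C + 2 * (K / s + 1) * (b - a)) => r r0.
have Ks : 0 < K / s by rewrite divr_gt0.
have rs : 0 <= r / s by rewrite divr_ge0 // ltW.
have up : (Defs.card (window a b r))%:R <= C + 2 * (r / s + K / s + 1) * (b - a).
  pose N := (Num.truncn ((r + K) / s)).+1.
  have N1 : (r + K) / s < N%:R by rewrite truncnS_gt.
  have N2 : N%:R <= (r + K) / s + 1.
    by rewrite -natr1 lerD2r truncn_le mulrDl addr_ge0 // ltW.
  have := @card_le_size R _ _ (@window_sub_box R a b r K N ab K1 K3 _).
  rewrite -/s -ltr_pdivrMr // => /(_ N1); rewrite -(ler_nat R) => cN.
  have := hbox N; rewrite ler_norml => /andP[_ hN].
  rewrite mulrDl in N2.
  have : N%:R * (b - a) <= (r / s + K / s + 1) * (b - a).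
    by rewrite ler_wpM2r // subr_ge0.
  by lra.
have lo : - C + 2 * (r / s - K / s - 1) * (b - a) <= (Defs.card (window a b r))%:R.
  (* [Num.truncn] is 0 at negative arguments, which leads to the empty box. *)
  pose N := Num.truncn ((r - K) / s).
  have N1 : (r - K) / s < N.+1%:R by rewrite truncnS_gt.
  have N2 : N = 0%N \/ N%:R * s <= r - K.
    case: (lerP 0 ((r - K) / s)) => h.
      by right; rewrite -ler_pdivlMr // truncn_le.
    by left; apply/truncn0Pn; rewrite -ltNge (lt_trans h).
  have fW : finite_set (window a b r).
    pose N' := (Num.truncn ((r + K) / s)).+1.
    apply: sub_finite_set (finite_seq (box a b (- N'%:Z) (N' + N'))).
    by apply: (@window_sub_box R a b r K) => //; rewrite -ltr_pdivrMr // truncnS_gt.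
  have := size_le_card R _ _ fW (box_uniq R a b _ _)
    (@box_sub_window R a b r K N ab K1 K2 N2).
  rewrite -(ler_nat R) => cN.
  have := hbox N; rewrite ler_norml => /andP[hN _].
  rewrite -natr1 mulrBl in N1.
  have : (r / s - K / s - 1) * (b - a) <= N%:R * (b - a).
    by rewrite ler_wpM2r ?subr_ge0 //; lra.
  by lra.
have -> : 2 / s * (b - a) * r = 2 * (r / s) * (b - a) by ring.
by rewrite ler_norml; apply/andP; split; lra.
Qed.

(** * Overlaps of windows and their scaling *)

(* The length of the intersection of the intervals (a, b] and (c, d]. *)
Definition overlap {R : realDomainType} (a b c d : R) : R :=
  Num.max 0 (Num.min b d - Num.max a c).

Lemma overlapC (R : realDomainType) (a b c d : R) :
  overlap a b c d = overlap c d a b.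
Proof. by rewrite /overlap minC [Num.max a c]maxC. Qed.

(** The map y |-> s - k * y reverses orientation, hence the exchanged endpoints; lengths scale by
    [k] whatever the translation [s]. *)
Lemma overlap_scale (R : realDomainType) (k s a b c d : R) : 0 <= k ->
  k * overlap a b c d =
  overlap (s - k * b) (s - k * a) (s - k * d) (s - k * c).
Proof.
move=> k0; rewrite /overlap maxr_pMr // mulr0 mulrBr minr_pMr // maxr_pMr //.
rewrite -addr_minr -addr_maxr -oppr_max -oppr_min.
by congr Num.max; ring.
Qed.

Lemma overlap_split (R : realFieldType) (m a b c d : R) : a <= m <= b ->
  c <= d -> overlap a b c d = overlap a m c d + overlap m b c d.
Proof.
move=> amb cd; rewrite /overlap.
case: (lerP a c) => ac; case: (lerP m c) => mc; try (exfalso; lra);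
case: (lerP b d) => bd; case: (lerP m d) => md; try (exfalso; lra);
rewrite ?subrr;
repeat match goal with |- context [Num.max 0 ?x] =>
  case: (lerP 0 x) => ?; try (exfalso; lra) end; lra.
Qed.

(* For z with star image w, this is the length of
   W_al `&` (W_be - w), to which nu al be z is proportional. *)
Definition win_overlap {R : realType} (al be : tile) (w : R) : R :=
  overlap (win_lo al) (win_hi al) (win_lo be - w) (win_hi be - w).

Lemma win_lo_le_hi (R : realType) (t : tile) : win_lo t <= win_hi t :> R.
Proof. by have := tau_bounds R; case: t => /=; lra. Qed.

Lemma win_overlap_splitr (R : realType) (al : tile) (w : R) :
  overlap (win_lo al) (win_hi al) (-1 - w) (tau - 1 - w) =
  win_overlap al Tb w + win_overlap al Ta w.
Proof.
have tb := tau_bounds R; rewrite overlapC (overlap_split _ (tau - 2 - w)) /=.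
- by rewrite overlapC [X in _ + X]overlapC.
- by apply/andP; split; lra.
- exact: win_lo_le_hi.
Qed.

Lemma win_overlap_splitl (R : realType) (be : tile) (w : R) :
  overlap (-1) (tau - 1) (win_lo be - w) (win_hi be - w) =
  win_overlap Tb be w + win_overlap Ta be w.
Proof.
have tb := tau_bounds R; rewrite (overlap_split _ (tau - 2)) //.
- by apply/andP; split; lra.
- by rewrite lerD2r win_lo_le_hi.
Qed.

(** Up to endpoints, multiplication by -tau sends the window of [Ta] onto the whole window, and that
    of [Tb] onto the window of [Ta] shifted by 1. The whole window splits into its two types, and
    the shift accounts for [u - 1] and [u + 1]; in the last relation both windows are shifted and it
    cancels. *)
Lemma win_overlap_tau (R : realType) (w : R) (u := - tau * w) :
  [/\ tau * win_overlap Ta Ta w = win_overlap Ta Ta u + win_overlap Ta Tb u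
        + win_overlap Tb Ta u + win_overlap Tb Tb u,
      tau * win_overlap Ta Tb w
        = win_overlap Ta Ta (u - 1) + win_overlap Tb Ta (u - 1),
      tau * win_overlap Tb Ta w
        = win_overlap Ta Ta (u + 1) + win_overlap Ta Tb (u + 1) &
      tau * win_overlap Tb Tb w = win_overlap Ta Ta u].
Proof.
have tb := tau_bounds R; have t2 := tau_sqr R; have t0 : 0 <= tau :> R by lra.
have sc a b c d := overlap_scale R tau 0 a b c d t0.
have sc1 a b c d := overlap_scale R tau (-1) a b c d t0.
split.
- rewrite {1}/win_overlap sc /=.
  transitivity (overlap (-1) (tau - 1) (-1 - u) (tau - 1 - u)).
    by congr overlap; rewrite /u; ring: t2.
  rewrite (overlap_split _ (tau - 2)); [|apply/andP; split; lra|lra].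
  rewrite -[-1 in X in X + _]/(win_lo Tb) (win_overlap_splitr R Tb) (win_overlap_splitr R Ta).
  by ring.
- rewrite {1}/win_overlap sc /= [RHS]addrC -win_overlap_splitl.
  by congr overlap; rewrite /u /=; ring: t2.
- rewrite {1}/win_overlap sc1 /= [RHS]addrC -win_overlap_splitr.
  by congr overlap; rewrite /u /=; ring: t2.
- rewrite /win_overlap sc1 /=.
  by congr overlap; rewrite /u /=; ring: t2.
Qed.

(** * Pair correlations as limits of counting ratios *)

Lemma asymp_linear_div (R : realType) (f : R -> R) (l : R) :
  asymp_linear f l -> f r / r @[r --> +oo] --> l.
Proof.
move=> [C hC]; apply/cvgrPdist_le => e e0.
near=> r.
have r0 : 0 < r by near: r; exact: nbhs_pinfty_gt.
have -> : l - f r / r = - (f r - l * r) / r.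
  by rewrite mulNr mulrBl mulfK ?opprB // gt_eqF.
rewrite normrM normrN normfV (gtr0_norm r0) ler_pdivrMr //.
apply: le_trans (hC _ (ltW r0)) _.
by rewrite mulrC -ler_pdivrMr //.
Unshelve. all: by end_near. Qed.

Lemma asymp_linear_ratio (R : realType) (f g : R -> R) (l k : R) :
  asymp_linear f l -> asymp_linear g k -> k != 0 ->
  f r / g r @[r --> +oo] --> l / k.
Proof.
move=> fl gk k0.
have h : (f r / r) / (g r / r) @[r --> +oo] --> l / k.
  by apply: cvgM; [|apply: cvgV => //]; exact: asymp_linear_div.
apply: cvg_trans h; apply: near_eq_cvg; near=> r.
have r0 : r != 0 by rewrite gt_eqF.
by rewrite /= invf_div mulrA divfK.
Unshelve. all: by end_near. Qed.

Lemma card0 (R : realType) : Defs.card (set0 : set R) = 0%N.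
Proof. by rewrite /Defs.card fset_set0 cardfs0. Qed.

(** Maximum and minimum select one of the given endpoints, so the length stays in Z[tau] and
    [card_window] applies; for disjoint intervals the window is empty and the overlap is cut off at
    0. *)
Lemma asymp_linear_overlap (R : realType) (a b c d : R) :
  (exists p q, a = zstar p q) -> (exists p q, b = zstar p q) ->
  (exists p q, c = zstar p q) -> (exists p q, d = zstar p q) ->
  asymp_linear
    (fun r => (Defs.card (window (Num.max a c) (Num.min b d) r))%:R)
    (2 / (2 * tau - 1) * overlap a b c d).
Proof.
move=> ha hb hc hd.
have [p [q eM]] : exists p q, Num.max a c = zstar p q by case: (lerP a c).
have [p' [q' em]] : exists p q, Num.min b d = zstar p q by case: (lerP b d).
rewrite /overlap; case: (lerP (Num.max a c) (Num.min b d)) => h.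
  rewrite [Num.max 0 _]max_r ?subr_ge0 //; apply: (card_window R _ _ (p' - p) (q' - q)) => //.
  by rewrite eM em; apply/eqP; rewrite subr_eq -zstarD !subrK.
rewrite [Num.max 0 _]max_l ?subr_le0 1?ltW //; exists 0 => r _.
have -> : window (Num.max a c) (Num.min b d) r = set0.
  apply/seteqP; split=> // x [m [n [_ _ /andP[h1 h2]]]].
  by move: h; rewrite ltNge (le_trans (ltW h1)).
by rewrite card0 mulr0 mul0r subrr normr0.
Qed.

Lemma win_lo_zstar (R : realType) (t : tile) : exists p q, win_lo t = zstar p q :> R.
Proof.
by case: t; [exists (-1), (-1)|exists (-1), 0]; rewrite /zstar /=; ring.
Qed.

Lemma win_hi_zstar (R : realType) (t : tile) : exists p q, win_hi t = zstar p q :> R.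
Proof.
by case: t; [exists 0, (-1)|exists (-1), (-1)]; rewrite /zstar /=; ring.
Qed.

Lemma LambdaE (R : realType) (r : R) :
  [set x | Lambda R x /\ - r < x < r] = window (-1) (tau - 1) r.
Proof.
have tb := tau_bounds R.
apply/seteqP; split=> x.
- by move=> [[] /LambdaP[m [n [-> /= /andP[w1 w2]]]] xr]; exists m, n; split=> //;
    apply/andP; split; lra.
- move=> [m [n [-> xr w]]]; split=> //.
  case: (lerP (zstar m n) (tau - 2 : R)) => h; [right|left];
    apply/LambdaP; exists m, n; split=> //=.
    by rewrite h andbT; case/andP: w.
  by rewrite h; case/andP: w.
Qed.

(** By [ztau_inj] the star image of the right point can only be that of [x] plus that of the
    distance, which turns both membership conditions into one interval. *)
Lemma pairsE (R : realType) (al be : tile) (p q : int) (r : R) :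
  [set x | Lambda_ R al x /\ - r < x < r /\ Lambda_ R be (x + ztau p q)] =
  window (Num.max (win_lo al) (win_lo be - zstar p q))
    (Num.min (win_hi al) (win_hi be - zstar p q)) r.
Proof.
apply/seteqP; split=> x /=.
- move=> [/LambdaP[m [n [-> w]]] [xr /LambdaP[m' [n' []]]]].
  rewrite -ztauD => /ztau_inj[<- <-]; rewrite zstarD => w'.
  exists m, n; split=> //.
  by rewrite gt_max le_min ltrBlDr lerBrDr andbACA w.
- move=> [m [n [-> xr]]].
  rewrite gt_max le_min ltrBlDr lerBrDr andbACA -zstarD => /andP[w w'].
  split; first by apply/LambdaP; exists m, n.
  split=> //; apply/LambdaP; exists (m + p), (n + q); split=> //.
  by rewrite ztauD.
Qed.

Lemma pair_ratio_cvg (R : realType) (al be : tile) (p q : int) :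
  pair_ratio al be (ztau p q) r @[r --> +oo] --> win_overlap al be (zstar p q : R) / tau.
Proof.
have tb := tau_bounds R.
set s : R := 2 / (2 * tau - 1).
have s0 : s != 0 by rewrite mulf_neq0 ?invr_neq0 ?pnatr_eq0 // gt_eqF //; lra.
have t0 : tau != 0 :> R by rewrite gt_eqF //; lra.
(* The density factor [s] is common to both counts, and [tau] is the length of the whole window. *)
have -> : win_overlap al be (zstar p q) / tau
    = s * win_overlap al be (zstar p q) / (s * tau) by rewrite -mulf_div divff // mul1r.
have -> : pair_ratio al be (ztau p q) = fun r : R =>
    (Defs.card (window (Num.max (win_lo al) (win_lo be - zstar p q))
      (Num.min (win_hi al) (win_hi be - zstar p q)) r))%:R /
    (Defs.card (window (-1) (tau - 1) r))%:R.
  by apply/funext => r; rewrite /pair_ratio pairsE LambdaE.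
have sub_zstar (x : R) : (exists p q, x = zstar p q) ->
    exists m n, x - zstar p q = zstar m n.
  move=> [m [n ->]]; exists (m - p), (n - q).
  by apply/eqP; rewrite subr_eq -zstarD !subrK.
apply: asymp_linear_ratio; last by rewrite mulf_neq0.
  by apply: asymp_linear_overlap; [exact: win_lo_zstar|exact: win_hi_zstar|
    exact/sub_zstar/win_lo_zstar|exact/sub_zstar/win_hi_zstar].
have := card_window R (-1) (tau - 1) 1 (-1); rewrite opprK subrK; apply; first lra.
by rewrite /zstar; ring.
Qed.

Lemma nuE (R : realType) (al be : tile) (p q : int) :
  nu al be (ztau p q) = win_overlap al be (zstar p q) / tau :> R.
Proof. exact: cvg_lim (pair_ratio_cvg R al be p q). Qed.

(** * Vanishing off the difference set and the final relations *)

Lemma pair_ratio_notin (R : realType) (al be : tile) (z : R) :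
  ~ [set y - x | y in Lambda_ R be & x in Lambda_ R al] z ->
  pair_ratio al be z = fun=> 0.
Proof.
move=> zN; apply/funext => r; rewrite /pair_ratio.
have -> : [set x | Lambda_ R al x /\ - r < x < r /\ Lambda_ R be (x + z)] = set0.
  apply/seteqP; split=> // x [Lx [_ Lxz]]; apply: zN.
  by exists (x + z) => //; exists x => //; rewrite addrAC subrr add0r.
by rewrite card0 mul0r.
Qed.

Theorem proposition2 (R : realType) :
  (forall (al be : tile) (z : R),
     cvg (pair_ratio al be z r @[r --> +oo])) /\
  (forall z : R, Ztau R z ->
     [/\ nu Ta Ta z = tau^-1 * (nu Ta Ta (z / tau) + nu Ta Tb (z / tau)
                                + nu Tb Ta (z / tau) + nu Tb Tb (z / tau)),
         nu Ta Tb z = tau^-1 * (nu Ta Ta (z / tau - 1) + nu Tb Ta (z / tau - 1)),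
         nu Tb Ta z = tau^-1 * (nu Ta Ta (z / tau + 1) + nu Ta Tb (z / tau + 1))
       & nu Tb Tb z = tau^-1 * nu Ta Ta (z / tau)]) /\
  (forall (al be : tile) (z : R),
     ~ [set y - x | y in Lambda_ R be & x in Lambda_ R al] z -> nu al be z = 0).
Proof.
have tb := tau_bounds R; have t0 : tau != 0 :> R by lra.
split; last split.
- move=> al be z.
  (* A difference of two chain points lies in Z[tau], where the limit is known; for any other [z]
     the ratio is constantly 0. *)
  have [[y Ly [x Lx <-]]|zN] :=
    pselect ([set y - x | y in Lambda_ R be & x in Lambda_ R al] z).
    move: Ly Lx => /LambdaP[m [n [-> _]]] /LambdaP[p [q [-> _]]].
    by rewrite -ztauB; apply/cvg_ex; eexists; exact: pair_ratio_cvg.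
  by rewrite pair_ratio_notin //; exact: is_cvg_cst.
- move=> _ [p [q ->]]; rewrite -[p%:~R + _]/(ztau p q) ztau_div_tau.
  rewrite -ztauB1 -ztauD1 !nuE zstarB1 zstarD1 zstar_div_tau.
  have [eaa eab eba ebb] := win_overlap_tau R (zstar p q).
  by split; rewrite -?mulrDl -?eaa -?eab -?eba -?ebb [tau * _]mulrC mulfK // mulrC.
- move=> al be z zN; rewrite /nu pair_ratio_notin //.
  by apply: cvg_lim => //; exact: cvg_cst.
Qed.
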